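(* Let $X$ be an infinite dimensional real Banach space. Then there exists a closed, bounded, convex set $K\subset X$ that is not remotal.
   Context: For a bounded set $C$ in a Banach space $Z$ and $z\in Z$, let $D(z,C)=\sup\{\|z-c\|: c\in C\}$. $C$ is remotal from $z$ if there exists $c_0\in C$ with $\|z-c_0\|=D(z,C)$; $C$ is remotal if it is remotal from every point of $Z$. *)

(* Defs.v *)
From Stdlib Require Import Reals Lra List.
Open Scope R_scope.

Record NormedSpace := {
  carrier :> Type;
  vzero : carrier;
  vadd : carrier -> carrier -> carrier;
  vopp : carrier -> carrier;
  vscal : R -> carrier -> carrier;
  vnorm : carrier -> R;
  vadd_assoc : forall x y z, vadd x (vadd y z) = vadd (vadd x y) z;
  vadd_comm : forall x y, vadd x y = vadd y x;
  vadd_0 : forall x, vadd x vzero = x;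
  vadd_opp : forall x, vadd x (vopp x) = vzero;
  vscal_1 : forall x, vscal 1 x = x;
  vscal_assoc : forall a b x, vscal a (vscal b x) = vscal (a * b) x;
  vscal_distr_v : forall a x y, vscal a (vadd x y) = vadd (vscal a x) (vscal a y);
  vscal_distr_r : forall a b x, vscal (a + b) x = vadd (vscal a x) (vscal b x);
  vnorm_nonneg : forall x, 0 <= vnorm x;
  vnorm_eq0 : forall x, vnorm x = 0 -> x = vzero;
  vnorm_scal : forall a x, vnorm (vscal a x) = Rabs a * vnorm x;
  vnorm_triangle : forall x y, vnorm (vadd x y) <= vnorm x + vnorm y
}.

Arguments vzero {_}.
Arguments vadd {_}.
Arguments vopp {_}.
Arguments vscal {_}.
Arguments vnorm {_}.

Definition vsub {X : NormedSpace} (x y : X) : X := vadd x (vopp y).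

Definition Cauchy_seq {X : NormedSpace} (u : nat -> X) : Prop :=
  forall eps, 0 < eps -> exists N, forall m n, (N <= m)%nat -> (N <= n)%nat ->
    vnorm (vsub (u m) (u n)) < eps.

Definition converges_to {X : NormedSpace} (u : nat -> X) (l : X) : Prop :=
  forall eps, 0 < eps -> exists N, forall n, (N <= n)%nat -> vnorm (vsub (u n) l) < eps.

Definition complete (X : NormedSpace) : Prop :=
  forall u : nat -> X, Cauchy_seq u -> exists l, converges_to u l.

Fixpoint lin_comb {X : NormedSpace} (cs : list R) (vs : list X) : X :=
  match cs, vs with
  | c :: cs', v :: vs' => vadd (vscal c v) (lin_comb cs' vs')
  | _, _ => vzero
  end.

Definition lin_indep {X : NormedSpace} (vs : list X) : Prop :=
  forall cs : list R, length cs = length vs ->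
    lin_comb cs vs = vzero -> Forall (fun c => c = 0) cs.

Definition infinite_dimensional (X : NormedSpace) : Prop :=
  forall n : nat, exists vs : list X, length vs = n /\ lin_indep vs.

Definition ns_closed {X : NormedSpace} (C : X -> Prop) : Prop :=
  forall (u : nat -> X) (l : X), (forall n, C (u n)) -> converges_to u l -> C l.

Definition ns_bounded {X : NormedSpace} (C : X -> Prop) : Prop :=
  exists M, forall c, C c -> vnorm c <= M.

Definition ns_convex {X : NormedSpace} (C : X -> Prop) : Prop :=
  forall x y t, C x -> C y -> 0 <= t <= 1 ->
    C (vadd (vscal t x) (vscal (1 - t) y)).

Definition dist_set {X : NormedSpace} (z : X) (C : X -> Prop) : R -> Prop :=
  fun r => exists c, C c /\ r = vnorm (vsub z c).

Definition remotal_from {X : NormedSpace} (C : X -> Prop) (z : X) : Prop :=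
  exists c0, C c0 /\ is_lub (dist_set z C) (vnorm (vsub z c0)).

Definition remotal {X : NormedSpace} (C : X -> Prop) : Prop :=
  forall z : X, remotal_from C z.

(* Main.v *)
(** Let [Y] be a separable infinite dimensional closed subspace and [(f_i)] functionals of norm at
most 1 norming a countable dense subset of [Y], so that they separate the points of [Y].
Take for [K] the set of [y] in [Y] with [|y| + b_i |f_i y| <= 1] for all [i], where
[b_i = 1 / (i + 1)]. A point of norm 1 in [K] would be killed by every [f_i], so all norms
in [K] are less than 1. On the other hand a unit vector [x] of [Y] killed by [f_0, ..., f_(n-1)]
gives the point [x / (1 + b_n)] of [K]; hence the supremum 1 of the norm on [K] is not
attained, and [K] is not remotal from the origin. *)

From Stdlib Require Import Reals Lra.
From mathcomp Require Import all_boot all_order all_algebra.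
From mathcomp Require Import boolp classical_sets reals Rstruct.
Require Import Defs.

Local Open Scope R_scope.

(** * Vector space and norm identities derived from the axioms *)

Section VectorAlgebra.
Context {X : NormedSpace}.
Implicit Types (x y z : X) (a t : R).

Lemma vadd_0l x : vadd vzero x = x.
Proof. by rewrite vadd_comm vadd_0. Qed.

Lemma vadd_swap x y z w : vadd (vadd x y) (vadd z w) = vadd (vadd x z) (vadd y w).
Proof. by rewrite !vadd_assoc -(vadd_assoc _ x y z) (vadd_comm _ y z) !vadd_assoc. Qed.

Lemma vadd_cancel x y z : vadd x z = vadd y z -> x = y.
Proof.
move=> /(f_equal (fun u => vadd u (vopp z))).
by rewrite -!vadd_assoc vadd_opp !vadd_0.
Qed.

Lemma vscal_0 x : vscal 0 x = vzero.
Proof. by apply: (vadd_cancel _ _ (vscal 0 x)); rewrite -vscal_distr_r vadd_0l Rplus_0_l. Qed.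

Lemma vscal_zero a : vscal a (@vzero X) = vzero.
Proof. by rewrite -(vscal_0 vzero) vscal_assoc Rmult_0_r vscal_0. Qed.

Lemma vopp_scal x : vopp x = vscal (-1) x.
Proof.
apply: (vadd_cancel _ _ x); rewrite vadd_comm vadd_opp -[in RHS](vscal_1 _ x).
by rewrite vscal_assoc -vscal_distr_r (_ : -1 * 1 + 1 = 0) ?vscal_0 //; lra.
Qed.

Lemma vsubD x y z w : vsub (vadd x y) (vadd z w) = vadd (vsub x z) (vsub y w).
Proof. by rewrite /vsub !vopp_scal vscal_distr_v vadd_swap. Qed.

Lemma vsubZ a x y : vsub (vscal a x) (vscal a y) = vscal a (vsub x y).
Proof. by rewrite /vsub !vopp_scal vscal_distr_v !vscal_assoc Rmult_comm. Qed.

Lemma vsub_scal a b x : vsub (vscal a x) (vscal b x) = vscal (a - b) x.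
Proof. rewrite /vsub vopp_scal vscal_assoc -vscal_distr_r; congr vscal; lra. Qed.

Lemma vsubK x y : vadd y (vsub x y) = x.
Proof. by rewrite /vsub vadd_comm -vadd_assoc (vadd_comm _ (vopp y)) vadd_opp vadd_0. Qed.

Lemma vsub_trans x y z : vsub x z = vadd (vsub x y) (vsub y z).
Proof. by rewrite {2}/vsub vadd_assoc (vadd_comm _ _ y) vsubK. Qed.

Lemma vnorm0 : vnorm (@vzero X) = 0.
Proof. by rewrite -(vscal_0 vzero) vnorm_scal Rabs_R0 Rmult_0_l. Qed.

Lemma vsubxx x : vsub x x = vzero. Proof. exact: vadd_opp. Qed.

Lemma vnorm_opp x : vnorm (vopp x) = vnorm x.
Proof. by rewrite vopp_scal vnorm_scal Rabs_Ropp Rabs_R1 Rmult_1_l. Qed.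

Lemma vnorm_sub_triangle x y z : vnorm (vsub x z) <= vnorm (vsub x y) + vnorm (vsub y z).
Proof. rewrite (vsub_trans x y z); exact: vnorm_triangle. Qed.

Lemma vnorm_le_sub x y : vnorm x <= vnorm y + vnorm (vsub x y).
Proof. by rewrite -{1}(vsubK x y); exact: vnorm_triangle. Qed.

Lemma vnorm_sub_sym x y : vnorm (vsub x y) = vnorm (vsub y x).
Proof.
rewrite -(vnorm_opp (vsub x y)) /vsub !vopp_scal vscal_distr_v vscal_assoc vadd_comm.
by rewrite (_ : -1 * -1 = 1) ?vscal_1 //; lra.
Qed.

End VectorAlgebra.

(** * Hahn-Banach: norming functionals through minimal sublinear functionals *)

Section HahnBanach.
Context {X : NormedSpace}.
Implicit Types (p q f : X -> R) (x y e : X).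

(** Homogeneity is only an inequality for [0 < t], a form that passes easily to infima; applying it
    to [t] and [/ t] recovers equality. *)
Definition sublinear p : Prop :=
  (forall x y, p (vadd x y) <= p x + p y) /\
  (forall t x, 0 < t -> p (vscal t x) <= t * p x).

Lemma sublinear_scal p t x : sublinear p -> 0 <= t -> p (vscal t x) = t * p x.
Proof.
move=> [pD pZ] t_ge0.
have p0 : p vzero = 0.
  have := pZ 2 vzero; have := pZ (/ 2) vzero; rewrite !vscal_zero; lra.
case: (Rle_lt_or_eq_dec _ _ t_ge0) => [t_gt0|<-]; last by rewrite vscal_0 p0; lra.
apply: Rle_antisym; first exact: pZ.
have /(Rmult_le_compat_l t) := pZ (/ t) (vscal t x) (Rinv_0_lt_compat _ t_gt0).
rewrite vscal_assoc Rinv_l ?vscal_1; last lra.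
move=> /(_ t_ge0); rewrite -Rmult_assoc Rinv_r; lra.
Qed.

Lemma sublinear_opp_ge p x : sublinear p -> - p (vopp x) <= p x.
Proof.
move=> p_sub; have := p_sub.1 x (vopp x); rewrite vadd_opp.
have := sublinear_scal p 0 vzero p_sub (Rle_refl 0); rewrite vscal_0; lra.
Qed.

Lemma inf_exists (I : Type) (i0 : I) (g : I -> R) m : (forall i, m <= g i) ->
  exists s, (forall i, s <= g i) /\ (forall m', (forall i, m' <= g i) -> m' <= s).
Proof.
move=> g_ge.
have [||s [s_ub s_lub]] := completeness (fun r => exists i, r = - g i).
- by exists (- m) => _ [i ->]; have := g_ge i; lra.
- by exists (- g i0), i0.
exists (- s); split=> [i|m' m'_le]; first by have := s_ub _ (ex_intro _ i erefl); lra.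
suff : s <= - m' by lra.
by apply: s_lub => _ [i ->]; have := m'_le i; lra.
Qed.

(** The pointwise infimum works: [b] keeps it finite, and the index [k] may depend on the points, so
    the single [F i] need not be sublinear. This serves both for tilting and for lower bounds of
    chains. *)
Lemma sublinear_inf (I : Type) (i0 : I) (F : I -> X -> R) (b : X -> R) :
  (forall i x, b x <= F i x) ->
  (forall i j x y, exists k, F k (vadd x y) <= F i x + F j y) ->
  (forall i t x, 0 < t -> exists k, F k (vscal t x) <= t * F i x) ->
  exists q, sublinear q /\ forall i x, q x <= F i x.
Proof.
move=> F_ge FD FZ.
have [q q_inf] := choice (fun x => inf_exists I i0 (F^~ x) _ (F_ge^~ x)).
have q_le x i : q x <= F i x by exact: (q_inf x).1.
have q_glb x m : (forall i, m <= F i x) -> m <= q x by exact: (q_inf x).2.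
exists q; split=> [|i x]; last exact: q_le.
split=> [x y|t x t_gt0].
  suff : q (vadd x y) - q y <= q x by lra.
  apply: (q_glb x) => i; suff : q (vadd x y) - F i x <= q y by lra.
  apply: q_glb => j; have [k Fk] := FD i j x y.
  by have := q_le (vadd x y) k; lra.
suff : / t * q (vscal t x) <= q x.
  by move=> /(Rmult_le_compat_l t _ _ (Rlt_le _ _ t_gt0)); rewrite -Rmult_assoc Rinv_r; lra.
apply: q_glb => i; have [k Fk] := FZ i t x t_gt0.
apply: (Rmult_le_reg_l t) => //; rewrite -Rmult_assoc Rinv_r; last lra.
by have := q_le (vscal t x) k; lra.
Qed.

(* The witness is the infimum over [t >= 0] of [p (y + t x) - t p x]; it makes every minimal
   sublinear functional additive. *)
Lemma sublinear_tilt p x : sublinear p ->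
  exists q, sublinear q /\ (forall y, q y <= p y) /\ (forall y, q y <= p (vadd y x) - p x).
Proof.
move=> p_sub.
pose F (t : {t : R | 0 <= t}) y := p (vadd y (vscal (sval t) x)) - sval t * p x.
have le01 : 0 <= 1 by lra.
have [|||q [q_sub q_le]] := sublinear_inf _ (exist _ 0 (Rle_refl 0)) F (fun y => - p (vopp y)).
- move=> [t t_ge0] y; rewrite /F /=.
  have := p_sub.1 (vadd y (vscal t x)) (vopp y).
  rewrite (vadd_comm _ y) -vadd_assoc vadd_opp vadd_0.
  rewrite (sublinear_scal p t x p_sub t_ge0); lra.
- move=> [t t_ge0] [s s_ge0] y z.
  have ts_ge0 : 0 <= t + s by lra.
  exists (exist _ _ ts_ge0); rewrite /F /= vscal_distr_r vadd_swap.
  have := p_sub.1 (vadd y (vscal t x)) (vadd z (vscal s x)); lra.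
- move=> [s s_ge0] t y t_gt0.
  have ts_ge0 : 0 <= t * s by apply: Rmult_le_pos; lra.
  exists (exist _ _ ts_ge0); rewrite /F /= -vscal_assoc -vscal_distr_v.
  have := p_sub.2 t (vadd y (vscal s x)) t_gt0; lra.
exists q; split=> //; split=> y.
  by have := q_le (exist _ 0 (Rle_refl 0)) y; rewrite /F /= vscal_0 vadd_0; lra.
by have := q_le (exist _ 1 le01) y; rewrite /F /= vscal_1; lra.
Qed.

(** Zorn's lemma: the infimum of a chain of sublinear functionals below [p] is again sublinear. *)
Lemma minimal_sublinear p : sublinear p ->
  exists f, [/\ sublinear f, forall x, f x <= p x &
    forall q, sublinear q -> (forall x, q x <= f x) -> forall x, f x <= q x].
Proof.
move=> p_sub.
pose T := {q | sublinear q /\ forall x, q x <= p x}.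
have p_T : sublinear p /\ forall x, p x <= p x by split=> // x; lra.
(* The order is reversed, so that a maximal element is a minimal functional. *)
pose le (r s : T) := `[< forall x, sval s x <= sval r x >].
have [|||[f [f_sub f_le]] f_min] := ZL_preorder (exist _ p p_T : T) (R := le).
- by move=> r; apply/asboolP => x; lra.
- move=> r s t /asboolP rs /asboolP st; apply/asboolP => x.
  by have := rs x; have := st x; lra.
- move=> A A_tot.
  (* Adding [p] to the chain makes the index type inhabited even when [A] is empty. *)
  pose I := {r : T | r = exist _ p p_T \/ A r}.
  have I_tot (i j : I) : le (sval i) (sval j) \/ le (sval j) (sval i).
    case: i j => [r Hr] [s Hs] /=.
    case: Hr => [->|Ar]; first by left; apply/asboolP; exact: (svalP s).2.
    case: Hs => [->|As]; first by right; apply/asboolP; exact: (svalP r).2.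
    exact: A_tot.
  pose i0 : I := exist _ (exist _ p p_T) (or_introl erefl).
  have [|||q [q_sub q_le]] := sublinear_inf I i0 (fun i => sval (sval i)) (fun x => - p (vopp x)).
  + move=> i x; have [r_sub r_le] := svalP (sval i).
    have := r_le (vopp x); have := sublinear_opp_ge _ x r_sub; lra.
  + move=> i j x y; have [/asboolP ij|/asboolP ji] := I_tot i j.
      exists j; have := ij x; have := (svalP (sval j)).1.1 x y; lra.
    exists i; have := ji y; have := (svalP (sval i)).1.1 x y; lra.
  + by move=> i t x t_gt0; exists i; exact: (svalP (sval i)).1.2.
  have q_T : sublinear q /\ forall x, q x <= p x by split=> // x; exact: (q_le i0).
  exists (exist _ q q_T) => r Ar; apply/asboolP => x.
  exact: (q_le (exist _ r (or_intror Ar)) x).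
exists f; split=> // q q_sub q_le.
have q_T : sublinear q /\ forall x, q x <= p x.
  by split=> // x; have := q_le x; have := f_le x; lra.
exact/asboolP/(f_min (exist _ q q_T))/asboolP.
Qed.

Definition dual_ball f : Prop :=
  [/\ forall x y, f (vadd x y) = f x + f y, forall t x, f (vscal t x) = t * f x &
      forall x, Rabs (f x) <= vnorm x].

(** Tilting the norm along [e] gives [p] with [p (- e) <= - |e|]. A minimal [f] below [p] is linear,
    and [f (- e) <= - |e|] then forces [f e = |e|]. *)
Lemma norming_functional e : exists f, dual_ball f /\ f e = vnorm e.
Proof.
have norm_sub : sublinear (@vnorm X).
  split=> [|t x t_gt0]; first exact: vnorm_triangle.
  by rewrite vnorm_scal Rabs_pos_eq; lra.
have [p [p_sub [p_le p_tilt]]] := sublinear_tilt _ e norm_sub.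
have [f [f_sub f_le f_min]] := minimal_sublinear p p_sub.
have fD x y : f (vadd x y) = f x + f y.
  apply: Rle_antisym; first exact: f_sub.1.
  (* By minimality [f] lies below its own tilt along [y], which is superadditivity. *)
  have [q [q_sub [q_le q_tilt]]] := sublinear_tilt f y f_sub.
  have := f_min q q_sub q_le x; have := q_tilt x; lra.
have f0 : f vzero = 0 by have := fD vzero vzero; rewrite vadd_0; lra.
have fN x : f (vopp x) = - f x by have := fD x (vopp x); rewrite vadd_opp f0; lra.
have f_norm x : f x <= vnorm x by have := f_le x; have := p_le x; lra.
exists f; split; last first.
  have := f_norm e; have := f_le (vopp e); have := p_tilt (vopp e).
  by rewrite vadd_comm vadd_opp vnorm0 fN; lra.
split=> // [t x|x].
  case: (Rle_lt_dec 0 t) => t0; first exact: sublinear_scal.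
  have : f (vscal (- t) x) = - t * f x by apply: sublinear_scal => //; lra.
  have -> : vscal (- t) x = vopp (vscal t x).
    by rewrite vopp_scal vscal_assoc; congr vscal; lra.
  by rewrite fN; lra.
by apply: Rabs_le; have := f_norm x; have := f_norm (vopp x); rewrite fN vnorm_opp; lra.
Qed.

End HahnBanach.

(** * The closed span of a countable family *)

Section RationalSpan.
Context {X : NormedSpace} {I : countType} (w : I -> X).

(** Rational coefficients keep the combinations countable, so that [pickle] can enumerate them. *)
Definition rat_comb (l : seq (rat * I)%type) : X :=
  foldr (fun ci v => vadd (vscal (ratr ci.1 : R) (w ci.2)) v) vzero l.

Definition span_closure (y : X) : Prop :=
  forall eps, 0 < eps -> exists l, vnorm (vsub y (rat_comb l)) < eps.

Lemma rat_comb_cat l1 l2 : rat_comb (l1 ++ l2) = vadd (rat_comb l1) (rat_comb l2).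
Proof. by elim: l1 => [|ci l1 IH] /=; rewrite ?vadd_0l // IH vadd_assoc. Qed.

(** Taking the closure twice adds nothing; this gives real scalar multiples here and the closedness
    of [K] later. *)
Lemma span_closure_approx y :
  (forall eps, 0 < eps -> exists z, span_closure z /\ vnorm (vsub y z) < eps) -> span_closure y.
Proof.
move=> y_approx eps eps_gt0; have eps2 : 0 < eps / 2 by lra.
have [z [z_cl yz]] := y_approx _ eps2; have [l zl] := z_cl _ eps2.
by exists l; have := vnorm_sub_triangle y z (rat_comb l); lra.
Qed.

Lemma span_closure0 : span_closure vzero.
Proof. by move=> eps eps_gt0; exists [::]; rewrite /= vsubxx vnorm0. Qed.

Lemma span_closureD x y : span_closure x -> span_closure y -> span_closure (vadd x y).
Proof.
move=> x_cl y_cl eps eps_gt0; have eps2 : 0 < eps / 2 by lra.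
have [l1 xl] := x_cl _ eps2; have [l2 yl] := y_cl _ eps2; exists (l1 ++ l2).
rewrite rat_comb_cat vsubD.
by have := vnorm_triangle _ (vsub x (rat_comb l1)) (vsub y (rat_comb l2)); lra.
Qed.

Lemma span_closure_gen c i : span_closure (vscal c (w i)).
Proof.
move=> eps eps_gt0.
have w_ge0 := vnorm_nonneg _ (w i).
(* The [+ 1] covers the case [w i = 0]. *)
pose d := eps / (vnorm (w i) + 1).
have d_gt0 : 0 < d by apply: Rdiv_lt_0_compat; lra.
have [q [cq qd]] : exists q : rat, c < (ratr q : R) /\ (ratr q : R) < c + d.
  have /RltP/rat_in_itvoo[q] : c < c + d by lra.
  by rewrite in_itv /= => /andP[/RltP cq /RltP qd]; exists q.
exists [:: (q, i)]; rewrite /= vadd_0 vsub_scal vnorm_scal Rabs_minus_sym Rabs_pos_eq; last lra.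
apply: (Rle_lt_trans _ (d * vnorm (w i))); first by apply: Rmult_le_compat_r => //; lra.
have : d * (vnorm (w i) + 1) = eps by rewrite /d; field; lra.
lra.
Qed.

(** A real multiple of a rational combination need not be one, so combinations are treated generator
    by generator, and general points by approximation. *)
Lemma span_closureZ c x : span_closure x -> span_closure (vscal c x).
Proof.
have rat_combZ l : span_closure (vscal c (rat_comb l)).
  elim: l => [|[q i] l IH] /=; first by rewrite vscal_zero; exact: span_closure0.
  rewrite vscal_distr_v vscal_assoc; apply: span_closureD => //; exact: span_closure_gen.
move=> x_cl; apply: span_closure_approx => eps eps_gt0.
have c_ge0 := Rabs_pos c.
have d_gt0 : 0 < eps / (Rabs c + 1) by apply: Rdiv_lt_0_compat; lra.
have [l xl] := x_cl _ d_gt0; exists (vscal c (rat_comb l)); split=> //.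
rewrite vsubZ vnorm_scal.
have : (Rabs c + 1) * (eps / (Rabs c + 1)) = eps by field; lra.
have := Rmult_le_compat_l _ _ _ c_ge0 (Rlt_le _ _ xl); lra.
Qed.

Lemma span_closure_lin_comb cs vs :
  (forall j, span_closure (nth vzero vs j)) -> span_closure (lin_comb cs vs).
Proof.
elim: cs vs => [|c cs IH] [|v vs] //= vs_cl; try exact: span_closure0.
apply: span_closureD; first exact: span_closureZ _ _ (vs_cl 0%N).
by apply: IH => j; exact: (vs_cl j.+1).
Qed.

End RationalSpan.

(** * Nonzero common zeros of finitely many functionals *)

Section CommonKernel.
Context {X : NormedSpace}.

Lemma dual_lin_comb (f : X -> R) cs vs : dual_ball f -> size cs = size vs ->
  f (lin_comb cs vs) = (\sum_(j < size vs) cs`_j * f (nth vzero vs j))%R.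
Proof.
move=> [fD fZ _]; elim: cs vs => [|c cs IH] [|v vs] //=.
  by rewrite big_ord0 -(vscal_0 vzero) fZ Rmult_0_l.
by move=> [sz]; rewrite big_ord_recl /= fD fZ IH.
Qed.

Lemma Forall_nth (T : Type) (P : T -> Prop) (x0 : T) s j :
  List.Forall P s -> (j < size s)%N -> P (nth x0 s j).
Proof. by move=> Ps; elim: Ps j => [|x l Px _ IH] [|j] //=; exact: IH. Qed.

(** The [n.+1] by [n] matrix of values has a nonzero left kernel vector; its entries are the
    coefficients, and independence keeps the combination nonzero. *)
Lemma common_kernel (f : nat -> X -> R) n vs : (forall i, dual_ball (f i)) ->
  size vs = n.+1 -> lin_indep vs ->
  exists cs, lin_comb cs vs <> vzero /\ forall i, (i < n)%N -> f i (lin_comb cs vs) = 0.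
Proof.
move=> f_dual sz vs_free.
pose A : 'M[R]_(n.+1, n) := (\matrix_(j, i) f i (nth vzero vs j))%R.
have /rowV0Pn[c /sub_kermxP cA c_neq0] : kermx A != 0%R.
  by rewrite kermx_eq0 /row_free neq_ltn ltnS rank_leq_col.
pose cs := [seq c ord0 j | j <- enum 'I_n.+1].
have sz_cs : size cs = size vs by rewrite size_map size_enum_ord.
have cs_nth (j : 'I_n.+1) : (cs`_j)%R = c ord0 j.
  by rewrite (nth_map ord0) ?size_enum_ord // nth_ord_enum.
exists cs; split=> [comb0|i i_lt].
  case/negP: c_neq0; apply/eqP/rowP => j; rewrite mxE -cs_nth.
  by apply: Forall_nth (vs_free cs sz_cs comb0) _; rewrite sz_cs sz.
rewrite dual_lin_comb // sz.
have /rowP/(_ (Ordinal i_lt)) := cA; rewrite !mxE => cAi; apply: etrans cAi.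
by apply: eq_bigr => j _; rewrite cs_nth mxE.
Qed.

End CommonKernel.

(** * Construction of the non-remotal set *)

Theorem theorem7 (X : NormedSpace) (HX : complete X) (Hinf : infinite_dimensional X) :
  exists K : X -> Prop,
    (exists k, K k) /\ ns_closed K /\ ns_bounded K /\ ns_convex K /\ ~ remotal K.
Proof.
have [vs vs_free] := choice (fun n => Hinf n.+1).
have [F F_norming] := choice (fun e : X => norming_functional e).
(* All the free families are merged into one countable family; out-of-range indices give only
   [vzero]. *)
pose w (nj : nat * nat) := nth vzero (vs nj.1) nj.2.
pose Y := span_closure w.
pose f i := F (if unpickle i is Some l then rat_comb w l else vzero).
have f_dual i : dual_ball (f i) by exact: (F_norming _).1.
pose b (i : nat) := / INR i.+1.
have b_gt0 i : 0 < b i by apply/Rinv_0_lt_compat/lt_0_INR/Nat.lt_0_succ.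
have b_anti n i : (n <= i)%N -> b i <= b n.
  move=> ni; apply: Rinv_le_contravar; first exact/lt_0_INR/Nat.lt_0_succ.
  exact/le_INR/leP.
pose K y := Y y /\ forall i, vnorm y + b i * Rabs (f i y) <= 1.
have K_le1 y : K y -> vnorm y <= 1.
  move=> [_ /(_ 0%N)]; have := Rmult_le_pos _ _ (Rlt_le _ _ (b_gt0 0%N)) (Rabs_pos (f 0%N y)).
  by lra.
have K_lt1 y : K y -> vnorm y < 1.
  move=> Ky; have [Yy y_le] := Ky; case: (Rle_lt_or_eq_dec _ _ (K_le1 y Ky)) => // y1.
  (* Let [r] be the combination of [l]. If [|y| = 1], every [f i] kills [y], so
     [|r| = f r = f (r - y) < 1/4], against [|r| > 3/4]. *)
  have [|l yl] := Yy (/ 4); first lra.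
  have [fD fZ f_le] := f_dual (pickle l).
  have fl : f (pickle l) (rat_comb w l) = vnorm (rat_comb w l).
    by rewrite /f pickleK; exact: (F_norming _).2.
  have fy0 : f (pickle l) y = 0.
    case: (Req_dec (f (pickle l) y) 0) => // /Rabs_pos_lt fy_gt0.
    by have := y_le (pickle l); have := Rmult_lt_0_compat _ _ (b_gt0 (pickle l)) fy_gt0; lra.
  have := f_le (vsub (rat_comb w l) y); have := Rle_abs (f (pickle l) (vsub (rat_comb w l) y)).
  have := fD y (vsub (rat_comb w l) y); rewrite vsubK fl fy0.
  by have := vnorm_le_sub y (rat_comb w l); rewrite (vnorm_sub_sym (rat_comb w l)); lra.
have K_large n : exists y, K y /\ vnorm y = / (1 + b n).
  have [sz free] := vs_free n.
  have [cs [x_neq0 fx0]] := common_kernel f n (vs n) f_dual sz free.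
  set x := lin_comb cs (vs n) in x_neq0 fx0.
  have Yx : Y x.
    apply: span_closure_lin_comb => j; rewrite -(vscal_1 _ (nth _ _ _)).
    exact: (span_closure_gen w 1 (n, j)).
  have x_gt0 : 0 < vnorm x.
    case: (Rle_lt_or_eq_dec _ _ (vnorm_nonneg _ x)) => // /esym /vnorm_eq0 //.
  have bn := b_gt0 n.
  pose a := / (1 + b n) / vnorm x.
  have a_gt0 : 0 < a by apply: Rdiv_lt_0_compat => //; apply: Rinv_0_lt_compat; lra.
  have norm_ax : vnorm (vscal a x) = / (1 + b n).
    by rewrite vnorm_scal Rabs_pos_eq; [rewrite /a; field; lra | lra].
  exists (vscal a x); split=> //; split=> [|i]; first exact: span_closureZ.
  have [fD fZ f_le] := f_dual i.
  have inv1 : / (1 + b n) * (1 + b n) = 1 by field; lra.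
  have inv_gt0 : 0 < / (1 + b n) by apply: Rinv_0_lt_compat; lra.
  (* For [n <= i] the bounds [b i <= b n] and [|f i (a x)| <= |a x|] suffice, since
     [|a x| (1 + b n) = 1]; for [i < n] the functional vanishes at [x]. *)
  case: (leqP n i) => ni.
    have := f_le (vscal a x); rewrite norm_ax.
    by have := b_anti n i ni; have := b_gt0 i; have := Rabs_pos (f i (vscal a x)); nra.
  by rewrite fZ fx0 // Rmult_0_r Rabs_R0 norm_ax; nra.
exists K; split; [|split; [|split; [|split]]].
- by have [y [Ky _]] := K_large 0%N; exists y.
- move=> u l Ku u_l; split.
    apply: span_closure_approx => eps /u_l[N uN]; exists (u N); split; first exact: (Ku N).1.
    by rewrite vnorm_sub_sym; exact: uN.
  move=> i; have [fD fZ f_le] := f_dual i; have bi := b_gt0 i.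
  apply: Rnot_lt_le => gt1.
  (* The excess of the constraint at [l], divided by the Lipschitz bound [1 + b i] of its left
     side. *)
  pose eps := (vnorm l + b i * Rabs (f i l) - 1) / (1 + b i).
  have eps_gt0 : 0 < eps by apply: Rdiv_lt_0_compat; lra.
  have eps_eq : eps * (1 + b i) = vnorm l + b i * Rabs (f i l) - 1 by rewrite /eps; field; lra.
  have [N /(_ N (le_n N)) uN] := u_l eps eps_gt0; rewrite vnorm_sub_sym in uN.
  have := (Ku N).2 i; have := vnorm_le_sub l (u N); have := f_le (vsub l (u N)).
  have : Rabs (f i l) <= Rabs (f i (u N)) + Rabs (f i (vsub l (u N))).
    by rewrite -{1}(vsubK l (u N)) fD; exact: Rabs_triang.
  nra.
- by exists 1.
- move=> x y t [Yx x_le] [Yy y_le] [t_ge0 t_le1].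
  split=> [|i]; first by apply: span_closureD; exact: span_closureZ.
  have [fD fZ f_le] := f_dual i; rewrite fD !fZ.
  have := vnorm_triangle _ (vscal t x) (vscal (1 - t) y); rewrite !vnorm_scal.
  have := Rabs_triang (t * f i x) ((1 - t) * f i y); rewrite !Rabs_mult.
  rewrite (Rabs_pos_eq t) // (Rabs_pos_eq (1 - t)); last lra.
  have := b_gt0 i; have := x_le i; have := y_le i => yi xi bi f_tri n_tri.
  have := Rmult_le_compat_l (b i) _ _ (Rlt_le _ _ bi) f_tri.
  have := Rmult_le_compat_l t _ _ t_ge0 xi.
  have := Rmult_le_compat_l (1 - t) _ _ ltac:(lra) yi.
  lra.
move=> /(_ vzero)[c [Kc [c_ub _]]].
have norm0 y : vnorm (vsub vzero y) = vnorm y by rewrite /vsub vadd_0l vnorm_opp.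
(* With [/ N < 1 - |c|], the point of norm [/ (1 + b N) > 1 - b N >= 1 - / N] is farther from the
   origin than [c]. *)
have [N [N_lt N_gt0]] := archimed_cor1 (1 - vnorm c) ltac:(have := K_lt1 c Kc; lra).
have [y [Ky y_norm]] := K_large N.
have := c_ub _ (ex_intro _ y (conj Ky erefl)); rewrite !norm0 y_norm.
have bN : b N <= / INR N.
  by apply: Rinv_le_contravar; [exact: lt_0_INR | apply: le_INR; exact: Nat.le_succ_diag_r].
have bN_gt0 := b_gt0 N.
have inv1 : / (1 + b N) * (1 + b N) = 1 by field; lra.
have inv_gt0 : 0 < / (1 + b N) by apply: Rinv_0_lt_compat; lra.
nra.
Qed.
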